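(* Let $G_1$ and $G_2$ be graphs with $|V(G_1)| = m$, $|V(G_2)| = n$ and $m \geq n \geq 2$. Then $\chi_i(G_1 \vee G_2) \leq \min\{m + n,\ \max\{\chi_i(G_1), \chi_i(G_2)\} + m + 2\}$.
   Context: $G_1\vee G_2$ is the join: the disjoint union of $G_1$ and $G_2$ together with all edges joining each vertex of $G_1$ to each vertex of $G_2$. For a graph $G$, let $D(G)$ be the digraph obtained by replacing each edge $uv$ by the two opposite arcs $uv$ and $vu$, with arc set $A(G)$. Two distinct arcs $uv$ and $xy$ are adjacent if $u=x$, or $v=x$, or $y=u$. An incidence coloring is a map $\sigma: A(G)\to C$ assigning distinct colors to adjacent arcs; the incidence chromatic number $\chi_i(G)$ is the minimum $|C|$ over all incidence colorings. *)

(* Defs.v *)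
From mathcomp Require Import all_boot.
Set Implicit Arguments.
Unset Strict Implicit.
Unset Printing Implicit Defensive.

Record sgraph := SGraph {
  vertex :> finType;
  edge : rel vertex;
  edge_sym : symmetric edge;
  edge_irr : irreflexive edge }.

Section Join.
Variables G1 G2 : sgraph.

Definition join_edge : rel (G1 + G2)%type := fun x y =>
  match x, y with
  | inl u, inl v => edge u v
  | inr u, inr v => edge u v
  | _, _ => true
  end.

Lemma join_edge_sym : symmetric join_edge.
Proof. by case=> [u|u] [v|v] //=; apply: edge_sym. Qed.

Lemma join_edge_irr : irreflexive join_edge.
Proof. by case=> [u|u] /=; apply: edge_irr. Qed.

Definition join : sgraph := SGraph join_edge_sym join_edge_irr.
End Join.

Section IncidenceColoring.
Variable G : sgraph.

(* The arc set A(G) of D(G): each edge uv yields exactly the two ordered pairs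
   (u, v) and (v, u), since [edge] is symmetric and irreflexive. *)
Definition arc : finType := {p : G * G | edge p.1 p.2}.
Definition tail (a : arc) : G := (val a).1.
Definition head (a : arc) : G := (val a).2.

Definition arc_adj (a b : arc) : bool :=
  (a != b) && [|| tail a == tail b, head a == tail b | head b == tail a].

Definition incidence_coloring (C : eqType) (sigma : arc -> C) : bool :=
  [forall a, forall b, arc_adj a b ==> (sigma a != sigma b)].

Definition incidence_colorable (k : nat) : bool :=
  [exists sigma : {ffun arc -> 'I_k}, incidence_coloring sigma].

Lemma incidence_coloring_colorable (C : finType) (sigma : arc -> C) :
  incidence_coloring sigma -> incidence_colorable #|C|.
Proof.
move=> /forallP sP; apply/existsP; exists [ffun a => enum_rank (sigma a)].
apply/forallP=> a; apply/forallP=> b; rewrite !ffunE (inj_eq enum_rank_inj).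
by have /forallP := sP a; apply.
Qed.

Lemma ex_incidence_colorable : exists k, incidence_colorable k.
Proof.
exists #|arc|; apply: (@incidence_coloring_colorable _ id).
by apply/forallP=> a; apply/forallP=> b; apply/implyP=> /andP[].
Qed.

Definition chi_i : nat := ex_minn ex_incidence_colorable.

(* [chi_i] is the minimum of #|C| over all finite color sets C, not only over
   those of the form 'I_k. *)
Lemma chi_i_min (C : finType) (sigma : arc -> C) :
  incidence_coloring sigma -> chi_i <= #|C|.
Proof.
rewrite /chi_i; case: ex_minnP => k _ min_k sP.
exact/min_k/(incidence_coloring_colorable sP).
Qed.

Lemma chi_i_attained : exists sigma : arc -> 'I_chi_i, incidence_coloring sigma.
Proof.
rewrite /chi_i; case: ex_minnP => k /existsP[s sP] _.
by exists s.
Qed.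
End IncidenceColoring.

(* Main.v *)
(** For the bound [m + n], color every arc by its head.

    For the other bound, the arcs inside [G1] and those inside [G2] share no
    vertex, so a single palette of [maxn (chi_i G1) (chi_i G2)] colors serves
    both.  The arcs of the complete bipartite graph between the two sides get
    [m + 2] new colors: the vertices of [G1] and two extra colors x and y.
    Fix an injection [e] of the vertices of [G2] into those of [G1].  The arc
    from u to v (u in [G1], v in [G2]) is colored [e v], or y if [e v = u]; the
    opposite arc is colored u, or x if [e v = u]. *)

Require Import Defs.
From mathcomp Require Import all_boot.

(** Distinct arcs with a common head have different tails, so adjacency would make one of them a
    loop. *)
Lemma head_incidence_coloring (G : sgraph) : incidence_coloring (@Defs.head G).
Proof.
apply/forallP=> -[[u v] /= uv]; apply/forallP=> -[[x y] /= xy].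
apply/implyP=> /andP[]; rewrite /tail /Defs.head -val_eqE /= xpair_eqE.
move=> neq /or3P[] /eqP eqx; apply/eqP=> eqy; move: neq uv xy.
- by rewrite eqx eqy !eqxx.
- by rewrite -eqx -eqy edge_irr.
- by rewrite eqy eqx edge_irr.
Qed.

Lemma chi_i_le_card (G : sgraph) : chi_i G <= #|G|.
Proof. exact: chi_i_min (head_incidence_coloring G). Qed.

Section JoinColoring.
Context {G1 G2 : sgraph} {C : finType}.
Context {s1 : Defs.arc G1 -> C} {s2 : Defs.arc G2 -> C} {e : G2 -> G1}.

(* The colors x and y of the header are [None] and [Some None]. *)
Definition join_color (a : Defs.arc (join G1 G2)) : C + option (option G1) :=
  let: exist p pE := a in
  match p return edge p.1 p.2 -> C + option (option G1) with
  | (inl u, inl v) => fun uv => inl (s1 (exist _ (u, v) uv))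
  | (inr u, inr v) => fun uv => inl (s2 (exist _ (u, v) uv))
  | (inl u, inr v) => fun=> inr (Some (if e v == u then None else Some (e v)))
  | (inr v, inl u) => fun=> inr (if e v == u then None else Some (Some u))
  end pE.

Lemma join_color_incidence :
  incidence_coloring s1 -> incidence_coloring s2 -> injective e ->
  incidence_coloring join_color.
Proof.
move=> s1P s2P e_inj.
apply/forallP=> -[[[u|u] [v|v]] uv]; apply/forallP=> -[[[x|x] [y|y]] xy];
  apply/implyP=> /andP[]; rewrite /tail /Defs.head -val_eqE /= => neq adj //.
- have /forallP/(_ (exist _ (u, v) uv))/forallP/(_ (exist _ (x, y) xy)) := s1P.
  move/implyP=> s1xy; apply/eqP=> -[]; apply/eqP/s1xy.
  by rewrite /arc_adj -val_eqE; apply/andP.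
(* Arcs crossing in the same direction are adjacent only through a common tail; then [e v] and [e y]
   differ, and at most one of them is [u]. *)
- have{neq} : ~~ ((u == x) && (v == y)) := neq.
  have{adj} /eqP <- : u == x by move: adj; rewrite orbF.
  rewrite eqxx /= => /eqP neq; apply/eqP=> -[].
  case: eqP => [evu|_]; case: eqP => [eyu|_] //; last by case=> /e_inj.
  by case: neq; apply: e_inj; rewrite evu.
(* Arcs crossing in opposite directions: equal colors force [e v = y], and adjacency ([v = x] or
   [y = u]) then gives [e x = y] or [e v = u], where an extra color is used instead. *)
- move=> {neq}; apply/eqP=> -[].
  case: eqP => [_|evu]; case: eqP => [_|exy] // [evy].
  by case/orP: adj => /eqP[] eq_end; [apply: exy|apply: evu]; rewrite -eq_end.
- move=> {neq}; apply/eqP=> -[].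
  case: eqP => [_|euv]; case: eqP => [_|eyx] // [vey].
  by case/orP: adj => /eqP[] eq_end; [apply: eyx|apply: euv]; rewrite -eq_end.
- have{neq} : ~~ ((u == x) && (v == y)) := neq.
  have{adj} /eqP <- : u == x by move: adj; rewrite orbF.
  rewrite eqxx /= => /eqP neq; apply/eqP=> -[].
  case: eqP => [euv|_]; case: eqP => [euy|_] //; last by case.
  by case: neq; rewrite -euv.
- have /forallP/(_ (exist _ (u, v) uv))/forallP/(_ (exist _ (x, y) xy)) := s2P.
  move/implyP=> s2xy; apply/eqP=> -[]; apply/eqP/s2xy.
  by rewrite /arc_adj -val_eqE; apply/andP.
Qed.
End JoinColoring.

Lemma incidence_coloring_inj {G : sgraph} {C C' : eqType} {f : C -> C'}
    {s : Defs.arc G -> C} :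
  injective f -> incidence_coloring s -> incidence_coloring (f \o s).
Proof.
move=> f_inj /forallP sP; apply/forallP=> a; apply/forallP=> b.
by rewrite /= (inj_eq f_inj); have /forallP := sP a; apply.
Qed.

Lemma inj_of_leq_card {T T' : finType} :
  #|T| <= #|T'| -> {e : T -> T' | injective e}.
Proof.
move=> leTT'; exists (enum_val \o widen_ord leTT' \o enum_rank) => x y /=.
by move/enum_val_inj/(congr1 val)=> /= /val_inj/enum_rank_inj.
Qed.

Lemma chi_i_join_le (G1 G2 : sgraph) :
  #|G2| <= #|G1| ->
  chi_i (join G1 G2) <= maxn (chi_i G1) (chi_i G2) + #|G1| + 2.
Proof.
move=> /inj_of_leq_card[e e_inj].
have [s1 s1P] := chi_i_attained G1; have [s2 s2P] := chi_i_attained G2.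
have widen_inj k l (lekl : k <= l) : injective (widen_ord lekl).
  by move=> i j /(congr1 val) /= /val_inj.
have := chi_i_min (join_color_incidence
  (incidence_coloring_inj (widen_inj _ _ (leq_maxl (chi_i G1) (chi_i G2))) s1P)
  (incidence_coloring_inj (widen_inj _ _ (leq_maxr (chi_i G1) (chi_i G2))) s2P)
  e_inj).
by rewrite card_sum !card_option card_ord -addnA addn2.
Qed.

Theorem theorem4p3 (G1 G2 : sgraph) (m n : nat)
  (hm : #|G1| = m) (hn : #|G2| = n) (hnm : n <= m) (hn2 : 2 <= n) :
  chi_i (join G1 G2) <= minn (m + n) (maxn (chi_i G1) (chi_i G2) + m + 2).
Proof.
(* Here [m + n] becomes the number of vertices of the join. *)
rewrite leq_min -hm -hn -card_sum chi_i_le_card /=.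
by apply: chi_i_join_le; rewrite hm hn.
Qed.
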